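(* Let $M$ be an $n \times n$ random real symmetric matrix drawn from an orthogonally invariant ensemble. Let $b$ be a random vector in $\mathbb{R}^n$, independent of $M$ (with any distribution). Then $$\mathbb{P}\big( (M,b) \text{ is controllable} \big) = 1 - \mathbb{P}(b = 0).$$
   Context: Controllability: for an $n \times n$ matrix $A$ and a vector $b \in \mathbb{R}^n$, the pair $(A,b)$ is controllable if the $n \times n$ matrix with columns $b, Ab, \ldots, A^{n-1}b$ has rank $n$. Orthogonally invariant ensemble: an $n \times n$ random real symmetric matrix $M$ is drawn from an orthogonally invariant ensemble if it has probability distribution $$\mathbb{P}(dM) = \frac{1}{Z_n} \exp(-\operatorname{tr} Q(M))\, dM$$ on the space of $n \times n$ real symmetric matrices, where $dM$ is Lebesgue measure on the $n(n+1)/2$ algebraically independent entries of $M$ (the entries on and above the diagonal), $Q$ is a real-valued function on $\mathbb{R}$, $Q(M)$ is defined by the functional calculus for $M$ (so $\operatorname{tr} Q(M) = \sum_{i=1}^n Q(\lambda_i)$ with $\lambda_1, \ldots, \lambda_n$ the eigenvalues of $M$), and $Z_n = \int e^{-\operatorname{tr} Q(M)}\, dM$ is the normalization constant. It is implicit that $Q$ is such that this defines a probability distribution (i.e. $Q$ is measurable and $0 < Z_n < \infty$). *)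

(* Defs.v *)
From HB Require Import structures.
From mathcomp Require Import all_boot all_order all_algebra.
From mathcomp Require Import all_classical all_reals all_analysis.

Set Implicit Arguments.
Unset Strict Implicit.
Unset Printing Implicit Defensive.

Import Order.TTheory GRing.Theory Num.Theory.

Local Open Scope classical_set_scope.
Local Open Scope ring_scope.

Definition controllability_mx (R : comNzRingType) (n : nat)
    (A : 'M[R]_n) (b : 'cV[R]_n) : 'M[R]_n :=
  \matrix_(i < n, k < n) ((A ^+ k) *m b) i 0.

Definition controllable (F : fieldType) (n : nat)
    (A : 'M[F]_n) (b : 'cV[F]_n) : bool :=
  \rank (controllability_mx A b) == n.

Definition measure_matrix_display : measure_display -> measure_display.
Proof. exact. Qed.

(* Matrices carry the product sigma-algebra: the one generated by the entries.
   Over a realType this is the Borel sigma-algebra. *)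
Section measurable_matrix.
Context {d : measure_display} {T : measurableType d}.
Variables m n : nat.

Definition measurable_mx : set (set 'M[T]_(m, n)) :=
  <<s \bigcup_(ij in [set: 'I_m * 'I_n])
        preimage_set_system setT (fun A : 'M[T]_(m, n) => A ij.1 ij.2)
          measurable >>.

Let measurable_mx0 : measurable_mx set0.
Proof. exact: sigma_algebra0. Qed.

Let measurable_mxC A : measurable_mx A -> measurable_mx (~` A).
Proof. exact: sigma_algebraC. Qed.

Let measurable_mx_bigcup (F : (set 'M[T]_(m, n))^nat) :
  (forall i, measurable_mx (F i)) -> measurable_mx (\bigcup_i (F i)).
Proof. exact: sigma_algebra_bigcup. Qed.

HB.instance Definition _ := @isMeasurable.Build (measure_matrix_display d)
  'M[T]_(m, n) measurable_mx
  measurable_mx0 measurable_mxC measurable_mx_bigcup.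

End measurable_matrix.

Lemma measurable_fun_mxP d1 d2 (T1 : measurableType d1) (T2 : measurableType d2)
    m n (f : T1 -> 'M[T2]_(m, n)) :
  measurable_fun [set: T1] f <->
  forall i j, measurable_fun [set: T1] (fun x => f x i j).
Proof.
split=> [mf i j|mf].
  move=> _ Y mY; rewrite setTI.
  have := mf measurableT ((fun A : 'M[T2]_(m, n) => A i j) @^-1` Y).
  rewrite setTI; apply; apply: sub_sigma_algebra; exists (i, j) => //=.
  by exists Y => //; rewrite setTI.
apply: (measurability (\bigcup_(ij in [set: 'I_m * 'I_n])
  preimage_set_system setT (fun A : 'M[T2]_(m, n) => A ij.1 ij.2)
    measurable)) => //.
move=> _ [_ [[i j] _ [Y mY <-]] <-]; rewrite setTI.
by have := mf i j measurableT Y mY; rewrite !setTI.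
Qed.

(* Lebesgue measure on R^(k+1), as the image of the product of the Lebesgue
   measures on R and R^k. *)
Section lebesgue_cons.
Context {R : realType} {k : nat}.
Variable mu : {sigma_finite_measure set (k.-tuple R) -> \bar R}.

Let cons_pair (p : measurableTypeR R * k.-tuple R) : k.+1.-tuple R :=
  [tuple of p.1 :: p.2].

Definition lebesgue_cons : set (k.+1.-tuple R) -> \bar R :=
  pushforward (lebesgue_measure \x mu)%E cons_pair.

Let mcons_pair : measurable_fun setT cons_pair.
Proof. by apply: measurable_cons. Qed.

Let lebesgue_cons0 : lebesgue_cons set0 = 0%E.
Proof. by rewrite /lebesgue_cons /pushforward preimage_set0 measure0. Qed.

Let lebesgue_cons_ge0 A : (0 <= lebesgue_cons A)%E.
Proof. exact: measure_ge0. Qed.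

Let lebesgue_cons_sigma_additive : semi_sigma_additive lebesgue_cons.
Proof.
exact: (@measure_semi_sigma_additive _ _ _
  (measure_function_pushforward__canonical__measure_function_Measure
     (lebesgue_measure \x mu)%E mcons_pair)).
Qed.

HB.instance Definition _ := isMeasure.Build _ _ _ lebesgue_cons
  lebesgue_cons0 lebesgue_cons_ge0 lebesgue_cons_sigma_additive.

Let lebesgue_cons_sigma_finite : sigma_finite setT lebesgue_cons.
Proof.
have /sigma_finiteP[F [TF ndF Foo]] := sigma_finiteT (@lebesgue_measure R).
have /sigma_finiteP[G [TG ndG Goo]] := sigma_finiteT mu.
pose split (t : k.+1.-tuple R) : measurableTypeR R * k.-tuple R :=
  (thead t, [tuple of behead t]).
have msplit : measurable_fun setT split.
  by apply/measurable_fun_pair => /=;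
    [exact: measurable_tnth|exact: measurable_behead].
have consK p : split (cons_pair p) = p.
  by case: p => x t; congr pair; apply/val_inj.
exists (fun i => split @^-1` (F i `*` G i)).
  rewrite -preimage_bigcup (_ : \bigcup_i (F i `*` G i) = setT) ?preimage_setT//.
  apply/seteqP; split=> // -[x y] _.
  have [n _ Fnx] : (\bigcup_i F i) x by rewrite -TF.
  have [m _ Gmy] : (\bigcup_i G i) y by rewrite -TG.
  exists (maxn n m) => //; split=> /=.
    by move: x Fnx; exact/subsetPset/ndF/leq_maxl.
  by move: y Gmy; exact/subsetPset/ndG/leq_maxr.
move=> i; have [mFi Fioo] := Foo i; have [mGi Gioo] := Goo i; split.
  by rewrite -[X in measurable X]setTI; apply: msplit => //; exact: measurableX.
rewrite /lebesgue_cons /pushforward -comp_preimage.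
rewrite (_ : split \o cons_pair = id); last by apply/funext => p /=.
by rewrite product_measure1E// lte_mul_pinfty// ge0_fin_numE.
Qed.

HB.instance Definition _ := Measure_isSigmaFinite.Build _ _ _ lebesgue_cons
  lebesgue_cons_sigma_finite.

End lebesgue_cons.

Fixpoint lebesgue_tuple (R : realType) (k : nat) :
    {sigma_finite_measure set (k.-tuple R) -> \bar R} :=
  match k with
  | 0 => \d_([tuple] : 0.-tuple R)
  | k'.+1 => lebesgue_cons (lebesgue_tuple R k')
  end.

Lemma lebesgue_tuple_box (R : realType) (k : nat) (B : 'I_k -> set R) :
  (forall i, measurable (B i)) ->
  lebesgue_tuple R k [set t | forall i, B i (tnth t i)] =
  (\prod_(i < k) lebesgue_measure (B i))%E.
Proof.
elim: k B => [|k IHk] B mB.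
  by rewrite big_ord0 /= diracE mem_set //= => -[].
rewrite big_ord_recl -(IHk (fun i => B (lift ord0 i)))//.
rewrite -product_measure1E//=; [|exact: mB|]; last first.
  rewrite (_ : [set t | _] = \bigcap_(i in [set: 'I_k])
    ((@tnth k R)^~ i @^-1` B (lift ord0 i))); last first.
    by apply/seteqP; split=> t /= Bt i; [move=> _|]; exact: Bt.
  apply: fin_bigcap_measurable => // i _; rewrite -[X in measurable X]setTI.
  exact: measurable_tnth.
rewrite /lebesgue_cons /pushforward; congr (_ _).
apply/seteqP; split=> -[x t] /=.
  move=> Bxt; split; first exact: (Bxt ord0).
  by move=> i; have := Bxt (lift ord0 i); rewrite tnthS.
move=> [Bx Bt] i; have [j ->|->] := unliftP ord0 i; last exact: Bx.
by rewrite tnthS; exact: Bt.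
Qed.

Definition upper_entries (n : nat) : {set 'I_n * 'I_n} :=
  [set ij : 'I_n * 'I_n | (ij.1 <= ij.2)%N].

Lemma card_upper_entries (n : nat) : #|upper_entries n| = 'C(n.+1, 2).
Proof.
rewrite -bin2_sum big_mkord big_ord_recl add0n -sum1_card.
rewrite (eq_bigl (fun ij : 'I_n * 'I_n => true && (ij.1 <= ij.2)%N)); last first.
  by move=> ij; rewrite inE.
rewrite -(pair_big_dep xpredT (fun i j : 'I_n => i <= j)%N (fun _ _ => 1%N)) /=.
rewrite (exchange_big_dep xpredT) //=; apply: eq_bigr => j _.
rewrite sum1_card /bump /= add1n -[RHS]card_ord.
rewrite -(card_codom (f := widen_ord (ltn_ord j))); last first.
  by move=> x y /(congr1 val) /= /val_inj.
apply: eq_card => i; apply/idP/codomP => [ij|[k ->]]; last exact: (ltn_ord k).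
by exists (Ordinal (ij : (i < j.+1)%N)); exact/val_inj.
Qed.

(* The symmetric matrix with a given list of entries on and above the diagonal,
   the positions being listed in the order of [enum (upper_entries n)]. *)
Definition sym_of_tuple (R : realType) (n : nat)
    (t : #|upper_entries n|.-tuple R) : 'M[R]_n :=
  \matrix_(i, j) nth 0 t
    (index (if (i <= j)%N then (i, j) else (j, i)) (enum (upper_entries n))).

Lemma sym_of_tuple_sym (R : realType) (n : nat)
    (t : #|upper_entries n|.-tuple R) : (sym_of_tuple t)^T = sym_of_tuple t.
Proof.
apply/matrixP => i j; rewrite !mxE.
by case: ltngtP => // /val_inj ->.
Qed.

Lemma measurable_sym_of_tuple (R : realType) (n : nat) :
  measurable_fun setT (@sym_of_tuple R n).
Proof.
apply/measurable_fun_mxP => i j; set ij := if (i <= j)%N then (i, j) else (j, i).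
have ijU : (index ij (enum (upper_entries n)) < #|upper_entries n|)%N.
  rewrite cardE index_mem mem_enum inE /ij.
  by case: (leqP i j) => //= /ltnW.
rewrite (_ : (fun x => _) = (@tnth _ R)^~ (Ordinal ijU)).
  exact: measurable_tnth.
by apply/funext => t; rewrite mxE -/ij (tnth_nth 0).
Qed.

(* Lebesgue measure dM on the entries on and above the diagonal, seen as a
   measure on 'M[R]_n carried by the symmetric matrices. *)
Section lebesgue_sym.
Context (R : realType) (n : nat).

Definition lebesgue_sym : set 'M[R]_n -> \bar R :=
  pushforward (lebesgue_tuple R #|upper_entries n|) (@sym_of_tuple R n).

Let lebesgue_sym0 : lebesgue_sym set0 = 0%E.
Proof. by rewrite /lebesgue_sym /pushforward preimage_set0 measure0. Qed.

Let lebesgue_sym_ge0 A : (0 <= lebesgue_sym A)%E.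
Proof. by rewrite /lebesgue_sym /pushforward measure_ge0. Qed.

Let lebesgue_sym_sigma_additive : semi_sigma_additive lebesgue_sym.
Proof.
exact: (@measure_semi_sigma_additive _ _ _
  (measure_function_pushforward__canonical__measure_function_Measure
     (lebesgue_tuple R #|upper_entries n|) (@measurable_sym_of_tuple R n))).
Qed.

HB.instance Definition _ := isMeasure.Build _ _ _ lebesgue_sym
  lebesgue_sym0 lebesgue_sym_ge0 lebesgue_sym_sigma_additive.

End lebesgue_sym.

Definition is_spectral_decomposition (R : realType) (n : nat)
    (A : 'M[R]_n) (U : 'M[R]_n) (d : 'rV[R]_n) : Prop :=
  U *m U^T = 1%:M /\ A = U *m diag_mx d *m U^T.

(* Q(A) = U diag(Q(d_1), ..., Q(d_n)) U^T for any orthogonal diagonalization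
   A = U diag(d_1, ..., d_n) U^T; the value 0 is used for a matrix that has none,
   that is, for a non-symmetric one. *)
Definition fun_calculus (R : realType) (n : nat) (Q : R -> R) (A : 'M[R]_n) :
    'M[R]_n :=
  xget 0 [set B | exists U d, is_spectral_decomposition A U d /\
                              B = U *m diag_mx (map_mx Q d) *m U^T].

Lemma fun_calculusE (R : realType) (n : nat) (Q : R -> R) (A U : 'M[R]_n)
    (d : 'rV[R]_n) : is_spectral_decomposition A U d ->
  fun_calculus Q A = U *m diag_mx (map_mx Q d) *m U^T.
Proof.
move=> AUd; rewrite /fun_calculus; case: xgetP => [B ->|/(_ _)/=]; last first.
  by move=> /(_ (U *m diag_mx (map_mx Q d) *m U^T))[]; exists U, d.
move=> [V [e [[VV AVe] ->]]]; case: AUd => UU AUd.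
have U'U : U^T *m U = 1%:M by exact: mulmx1C.
have V'V : V^T *m V = 1%:M by exact: mulmx1C.
pose W := V^T *m U.
have We : diag_mx e *m W = W *m diag_mx d.
  have := congr1 (fun X => V^T *m X *m U) (etrans (esym AVe) AUd).
  by rewrite !mulmxA V'V mul1mx -!mulmxA U'U mulmx1 !mulmxA.
have WQ : diag_mx (map_mx Q e) *m W = W *m diag_mx (map_mx Q d).
  move: W We => W We; apply/matrixP => i j; have /matrixP/(_ i j) := We.
  rewrite !mul_diag_mx !mul_mx_diag !mxE.
  have [->|W0] := eqVneq (W i j) 0; first by rewrite !mulr0 !mul0r.
  by rewrite [W i j * d 0 j]mulrC => /(mulIf W0) ->; rewrite mulrC.
have VW : V *m W = U by rewrite mulmxA VV mul1mx.
have WU : W *m U^T = V^T by rewrite -mulmxA UU mulmx1.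
by rewrite -[in LHS]WU mulmxA -(mulmxA V) WQ mulmxA VW.
Qed.

Lemma tr_fun_calculus (R : realType) (n : nat) (Q : R -> R) (A U : 'M[R]_n)
    (d : 'rV[R]_n) : is_spectral_decomposition A U d ->
  \tr (fun_calculus Q A) = \sum_i Q (d 0 i).
Proof.
move=> AUd; rewrite (fun_calculusE Q AUd) mxtrace_mulC mulmxA.
rewrite (mulmx1C (proj1 AUd)) mul1mx mxtrace_diag.
by apply: eq_bigr => i _; rewrite mxE.
Qed.

Definition partition_function (R : realType) (n : nat) (Q : R -> R) : \bar R :=
  (\int[@lebesgue_sym R n]_X (expR (- \tr (fun_calculus Q X)))%:E)%E.

Definition orthogonally_invariant_ensemble d (T : measurableType d)
    (R : realType) (P : probability T R) (n : nat) (M : {RV P >-> 'M[R]_n}) :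
    Prop :=
  (forall w, (M w)^T = M w) /\
  exists Q : R -> R,
    [/\ measurable_fun setT Q,
        (0 < partition_function n Q < +oo)%E &
        forall A : set 'M[R]_n, measurable A ->
          (distribution P M A =
           ((fine (partition_function n Q))^-1)%:E *
           \int[@lebesgue_sym R n]_(X in A)
             (expR (- \tr (fun_calculus Q X)))%:E)%E].

Definition independent_RV d d1 d2 (T : measurableType d)
    (T1 : measurableType d1) (T2 : measurableType d2)
    (R : realType) (P : probability T R)
    (X : {RV P >-> T1}) (Y : {RV P >-> T2}) : Prop :=
  forall A B, measurable A -> measurable B ->
    P (X @^-1` A `&` Y @^-1` B) = (P (X @^-1` A) * P (Y @^-1` B))%E.

(* Main.v *)
(** Only the absolute continuity of the law of [M] with respect to [dM] is used.
For fixed [v <> 0], the determinant of the controllability matrix of [(X, v)] is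
a polynomial in the entries of the symmetric matrix [X]. It is not the zero
polynomial: for [X] diagonal with distinct entries and [v] without zero entries
it is a Vandermonde determinant times the product of the entries of [v], and any
[v <> 0] is the image of a constant vector by a Householder reflection. Hence it
vanishes only on a Lebesgue-null set of symmetric matrices, and integrating over
[v] against the law of [b] (Fubini, by independence) gives the result. *)
Require Import Defs.
From mathcomp Require Import all_boot all_order all_algebra.
From mathcomp Require Import ring finmap measurable_realfun.
From mathcomp Require Import all_classical all_reals all_analysis.

Set Implicit Arguments.
Unset Strict Implicit.
Unset Printing Implicit Defensive.

Import Order.TTheory GRing.Theory Num.Theory.
Import HBNNSimple.

Local Open Scope classical_set_scope.
Local Open Scope ring_scope.

(** * Algebra of the controllability matrix *)

Lemma map_controllability_mx (R S : comNzRingType) (f : {rmorphism R -> S})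
    n (A : 'M[R]_n) (b : 'cV[R]_n) :
  map_mx f (controllability_mx A b) =
  controllability_mx (map_mx f A) (map_mx f b).
Proof.
have mapX k : map_mx f (A ^+ k) = map_mx f A ^+ k.
  elim: k => [|k IHk]; first by rewrite !expr0 map_mx1.
  by rewrite !exprS -IHk; exact: map_mxM.
by apply/matrixP => i k; rewrite [RHS]mxE -mapX -map_mxM [RHS]mxE 2!mxE.
Qed.

Lemma controllability_mx_conj (R : comNzRingType) n (A U V : 'M[R]_n)
    (b : 'cV[R]_n) : V *m U = 1%:M ->
  controllability_mx (U *m A *m V) (U *m b) = U *m controllability_mx A b.
Proof.
move=> VU; apply/matrixP => i k.
have -> : (U *m controllability_mx A b) i k = (U *m (A ^+ k *m b)) i 0.
  by rewrite !mxE; apply: eq_bigr => j _; rewrite !mxE.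
rewrite mxE; congr (fun_of_matrix _ i 0).
elim: (k : nat) => [|m IHm]; first by rewrite !expr0 !mul1mx.
rewrite !exprS -[LHS]mulmxA IHm -[(A * A ^+ m) *m b]mulmxA -!mulmxA.
by rewrite (mulmxA V) VU mul1mx.
Qed.

Lemma controllability_mx_diag (R : comNzRingType) n (d : 'rV[R]_n)
    (v : 'cV[R]_n) :
  controllability_mx (diag_mx d) v = diag_mx v^T *m (Vandermonde n d)^T.
Proof.
apply/matrixP => i k; rewrite [LHS]mxE mul_diag_mx.
have -> : diag_mx d ^+ k = diag_mx (map_mx (fun x => x ^+ k) d).
  elim: (k : nat) => [|m IHm].
    by apply/matrixP => a b; rewrite expr0 [LHS]mxE !mxE expr0.
  rewrite exprS IHm; apply: (etrans (mulmx_diag _ _)).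
  by congr diag_mx; apply/rowP => a; rewrite !mxE exprS.
by rewrite mul_diag_mx !mxE mulrC.
Qed.

Lemma controllableE (F : fieldType) n (A : 'M[F]_n) (b : 'cV[F]_n) :
  controllable A b = (\det (controllability_mx A b) != 0).
Proof. by rewrite -unitfE -unitmxE -row_free_unit. Qed.

Lemma not_controllable0 (F : fieldType) n (A : 'M[F]_n) :
  (0 < n)%N -> ~~ controllable A 0.
Proof.
move=> n0; rewrite /controllable (_ : controllability_mx A 0 = 0).
  by rewrite mxrank0 eq_sym -lt0n.
by apply/matrixP => i k; rewrite mxE mulmx0 !mxE.
Qed.

(** * Reflections and a symmetric partner for each nonzero vector *)

Lemma dotmxE (R : comPzRingType) n (v : 'cV[R]_n) :
  (v^T *m v) 0 0 = \sum_i v i 0 ^+ 2.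
Proof. by rewrite mxE; apply: eq_bigr => i _; rewrite mxE expr2. Qed.

Lemma dotmx_eq0 (F : realDomainType) n (v : 'cV[F]_n) :
  ((v^T *m v) 0 0 == 0) = (v == 0).
Proof.
rewrite dotmxE psumr_eq0; last by move=> i _; exact: sqr_ge0.
apply/allP/eqP => [v0|-> i _]; last by rewrite /= mxE expr0n.
apply/matrixP => i j; rewrite ord1 [RHS]mxE; apply/eqP.
by have := v0 i (mem_index_enum i); rewrite /= sqrf_eq0.
Qed.

(** For [a != b], take the reflection [1 - (2 / q) w w^T] with [w = a - b] and [q = w^T w]. Equal
    norms give [w^T a = q / 2], so [a] is sent to [a - w = b]. *)
Lemma householder (F : realFieldType) n (a b : 'cV[F]_n) :
  a^T *m a = b^T *m b ->
  exists2 U : 'M[F]_n, U^T = U /\ U *m U = 1%:M & U *m a = b.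
Proof.
move=> ab; have [->|neq] := eqVneq a b.
  by exists 1%:M; rewrite ?mul1mx ?trmx1.
pose w := a - b; pose q := (w^T *m w) 0 0.
have q0 : q != 0 by rewrite dotmx_eq0 subr_eq0.
have wwE : w^T *m w = q%:M by rewrite [LHS]mx11_scalar.
have waE : w^T *m a = (q / 2)%:M.
  rewrite [LHS]mx11_scalar; congr (_%:M); apply/eqP.
  rewrite eq_sym -(inj_eq (mulIf (_ : 2 != 0 :> F))) ?pnatr_eq0//.
  rewrite divfK ?pnatr_eq0//; apply/eqP; rewrite /q.
  have baE : b^T *m a = a^T *m b.
    by rewrite [LHS]mx11_scalar -[LHS]tr_scalar_mx -mx11_scalar trmx_mul trmxK.
  have -> : w^T = a^T - b^T by rewrite linearB.
  rewrite mulmxBl [(a^T - b^T) *m a]mulmxBl !mulmxBr -ab baE.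
  by move: (a^T *m a) (a^T *m b) => x y; rewrite !mxE; ring.
pose k := 2 / q.
have kkq : k * k * q = k + k by rewrite /k; field.
exists (1%:M - k *: (w *m w^T)); first split.
- by rewrite linearB linearZ /= trmx1 trmx_mul trmxK.
- rewrite mulmxBl mul1mx mulmxBr mulmx1 -scalemxAl -scalemxAr mulmxA.
  rewrite -(mulmxA w) wwE mul_mx_scalar -scalemxAl !scalerA mulrA kkq scalerDl.
  by rewrite opprB addrK subrK.
- rewrite mulmxBl mul1mx -scalemxAl -mulmxA waE mul_mx_scalar scalerA.
  rewrite (_ : k * (q / 2) = 1); last by rewrite /k; field.
  by rewrite scale1r opprB addrC subrK.
Qed.

Lemma exists_sym_controllable (F : rcfType) n (b : 'cV[F]_n) : b != 0 ->
  exists2 X : 'M[F]_n, X^T = X & controllable X b.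
Proof.
case: n b => [|n] b b0.
  by case/eqP: b0; apply/matrixP => -[].
pose q := (b^T *m b) 0 0.
have q0 : 0 < q.
  rewrite lt_def dotmx_eq0 b0 /q dotmxE sumr_ge0// => k _.
  exact: sqr_ge0.
(* The constant vector [c] in dimension [n.+1] must have the squared norm [q] of [b]. *)
pose c := Num.sqrt (q / n.+1%:R).
have c0 : c != 0 by rewrite sqrtr_eq0 -ltNge divr_gt0.
have [|U [UT UU] Uc] := @householder F n.+1 (const_mx c) b.
  rewrite [LHS]mx11_scalar [RHS]mx11_scalar -/q dotmxE; congr _%:M.
  under eq_bigr do rewrite mxE sqr_sqrtr ?divr_ge0 ?(ltW q0)//.
  by rewrite sumr_const card_ord -[LHS]mulr_natr divfK ?pnatr_eq0.
(* Any distinct eigenvalues would do: they make the Vandermonde determinant nonzero. As [U] is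
   symmetric and its own inverse, conjugating by it keeps the matrix symmetric. *)
pose d : 'rV[F]_n.+1 := \row_i i%:R.
exists (U *m diag_mx d *m U); first by rewrite !trmx_mul UT tr_diag_mx mulmxA.
rewrite controllableE -Uc controllability_mx_conj// det_mulmx.
rewrite controllability_mx_diag det_mulmx det_diag det_tr det_Vandermonde.
rewrite !mulf_neq0//.
- have : \det U * \det U != 0 by rewrite -det_mulmx UU det1 oner_neq0.
  by rewrite mulf_eq0 orbb.
- by apply/prodf_neq0 => i _; rewrite !mxE.
- apply/prodf_neq0 => i _; apply/prodf_neq0 => j ij; rewrite !mxE subr_eq0.
  by rewrite eqr_nat neq_ltn ij orbT.
Qed.

(** * Zero sets of polynomial functions of the upper entries *)

Lemma sym_of_tuple_surj (R : realType) n (X : 'M[R]_n) : X^T = X ->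
  exists t, sym_of_tuple t = X.
Proof.
move=> XT.
have sz : size [seq X ij.1 ij.2 | ij <- enum (upper_entries n)] ==
    #|upper_entries n| by rewrite size_map -cardE.
exists (Tuple sz); apply/matrixP => i j; rewrite mxE.
set ij := if (i <= j)%N then (i, j) else (j, i).
have ijU : ij \in enum (upper_entries n).
  by rewrite mem_enum inE /ij; case: (leqP i j) => //= /ltnW.
rewrite (nth_map ij) ?index_mem// nth_index// /ij.
by case: ifP => //= _; rewrite -[in LHS]XT mxE.
Qed.

(* An avatar of polynomial maps [R^k -> R] which avoids multivariate
   polynomials: [f] is polynomial along every polynomial curve. *)
Definition curve_polynomial (R : nzRingType) k (f : k.-tuple R -> R) : Prop :=
  forall l : R -> k.-tuple R,
    (forall i, exists p : {poly R}, forall s, tnth (l s) i = p.[s]) ->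
    exists p : {poly R}, forall s, f (l s) = p.[s].

Lemma finite_roots (F : idomainType) (p : {poly F}) : p != 0 ->
  finite_set [set x | p.[x] = 0].
Proof.
move=> p0; apply: contrapT => /(infinite_set_fset (size p))[B Bp].
rewrite leqNgt => /negP; apply; apply: max_poly_roots p0 _ (fset_uniq B).
by apply/allP => x xB; apply/rootP; exact: Bp.
Qed.

(** Induction on the dimension, integrating the measures of the slices over the first coordinate. *)
Lemma curve_polynomial_null (R : realType) k (f : k.-tuple R -> R) t0 :
  measurable_fun setT f -> curve_polynomial f -> f t0 != 0 ->
  lebesgue_tuple R k [set t | f t = 0] = 0%E.
Proof.
elim: k f t0 => [|k IHk] f t0 mf pf ft0 /=.
  (* In dimension 0 the measure is a Dirac mass at the only point, where [f] is nonzero. *)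
  by rewrite diracE memNset//= => ft; move: ft0; rewrite [t0]tuple0 ft eqxx.
case: (tupleP t0) ft0 => x0 u0 fxu0.
have mZ : measurable [set t | f t = 0].
  by rewrite -[X in measurable X]setTI; exact: (mf measurableT [set 0]).
rewrite /lebesgue_cons /pushforward; set Z := _ @^-1` _.
have mcons : measurable_fun setT
    (fun p : measurableTypeR R * k.-tuple R => [tuple of p.1 :: p.2]).
  exact: measurable_cons.
have {}mZ : measurable Z by rewrite -[Z]setTI; apply: mcons.
(* The line through [t0] along the first coordinate is a polynomial curve; [p] is nonzero because
   [p.[x0]] is. *)
have [p fp] : exists p : {poly R}, forall x, f [tuple of x :: u0] = p.[x].
  apply: (pf (fun x => [tuple of x :: u0])) => i.
  have [j ->|->] := unliftP ord0 i.
    by exists (tnth u0 j)%:P => s; rewrite tnthS hornerC.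
  by exists 'X => s; rewrite hornerX.
have p0 : p != 0.
  by apply: contra_neq fxu0 => p0; rewrite fp p0 horner0.
have fin := finite_roots p0.
(* Off the finitely many roots [x] of [p], the slice [f (x :: _)] does not vanish
   at [u0], so the induction hypothesis applies to it. *)
rewrite /product_measure1 (ae_eq_integral (cst 0%E)) ?integral0//.
  exact: measurable_fun_xsection.
exists [set x | p.[x] = 0]; split.
- exact/countable_measurable/finite_set_countable.
- exact/countable_lebesgue_measure0/finite_set_countable.
move=> x /=; apply: contra_notP => /eqP px _ /=.
rewrite (_ : xsection _ _ =
    [set u : k.-tuple R | f [tuple of (x : R) :: u] = 0]); last first.
  by apply/seteqP; split => u; rewrite /xsection /= inE.
apply: (IHk (fun u : k.-tuple R => f [tuple of (x : R) :: u]) u0);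
  last by rewrite fp.
- apply: (measurableT_comp mf).
  by apply: measurable_cons.
- move=> l lp; apply: (pf (fun s => [tuple of (x : R) :: l s])) => i.
  have [j ->|->] := unliftP ord0 i; last by exists x%:P => s; rewrite hornerC.
  by have [r lr] := lp j; exists r => s; rewrite tnthS.
Qed.

(** The same determinant, formed over [{poly R}] from the coordinates of the curve, is the required
    polynomial: evaluation at [s] is a ring morphism, so it commutes with [\det] and
    [controllability_mx]. *)
Lemma curve_polynomial_det_controllability (R : realType) n (v : 'cV[R]_n) :
  curve_polynomial (fun t => \det (controllability_mx (sym_of_tuple t) v)).
Proof.
move=> l /choice[p lp].
pose A : 'M[{poly R}]_n := \matrix_(i, j) nth 0 [tuple p i | i < _]
  (index (if (i <= j)%N then (i, j) else (j, i)) (enum (upper_entries n))).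
exists (\det (controllability_mx A (map_mx polyC v))) => s.
rewrite -[RHS]/(horner_eval s _) -det_map_mx map_controllability_mx.
congr (\det (controllability_mx _ _)); last first.
  by apply/matrixP => i j; rewrite !mxE [RHS]hornerC.
apply/matrixP => i j; rewrite !mxE [RHS]horner_evalE.
set ij := if (i <= j)%N then (i, j) else (j, i).
have ijU : (index ij (enum (upper_entries n)) < #|upper_entries n|)%N.
  rewrite cardE index_mem mem_enum inE /ij.
  by case: (leqP i j) => //= /ltnW.
by rewrite -[in LHS](tnth_nth 0 (l s) (Ordinal ijU)) lp
  -[in RHS](tnth_nth 0 _ (Ordinal ijU)) tnth_mktuple.
Qed.

(** * Measurability of matrix operations *)

Lemma measurable_det (R : realType) d (T : measurableType d) n
    (A : T -> 'M[R]_n) : measurable_fun setT A ->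
  measurable_fun setT (fun t => \det (A t)).
Proof.
move=> /measurable_fun_mxP mA; apply: measurable_sum => s.
by apply: measurable_funM => //; apply: measurable_prod => i _.
Qed.

Lemma measurable_mulmx (R : realType) d (T : measurableType d) m n p
    (A : T -> 'M[R]_(m, n)) (B : T -> 'M[R]_(n, p)) :
  measurable_fun setT A -> measurable_fun setT B ->
  measurable_fun setT (fun t => A t *m B t).
Proof.
move=> /measurable_fun_mxP mA /measurable_fun_mxP mB.
apply/measurable_fun_mxP => i j.
rewrite (_ : (fun _ => _) = fun t => \sum_k A t i k * B t k j); last first.
  by apply/funext => t; rewrite mxE.
by apply: measurable_sum => k; exact: measurable_funM.
Qed.

Lemma measurable_controllability_mx (R : realType) d (T : measurableType d) n
    (A : T -> 'M[R]_n) (b : T -> 'cV[R]_n) :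
  measurable_fun setT A -> measurable_fun setT b ->
  measurable_fun setT (fun t => controllability_mx (A t) (b t)).
Proof.
move=> mA mb; have mAX k : measurable_fun setT (fun t => A t ^+ k).
  elim: k => [|k IHk]; first exact: measurable_cst.
  under eq_fun do rewrite exprS.
  exact: (measurable_mulmx mA IHk).
apply/measurable_fun_mxP => i k.
under eq_fun do rewrite mxE.
have /measurable_fun_mxP mAXb := measurable_mulmx (mAX k) mb.
exact: mAXb.
Qed.

Lemma measurable_mx_set0 (R : realType) m n : measurable [set 0 : 'M[R]_(m, n)].
Proof.
rewrite (_ : [set 0] = \bigcap_(i in [set: 'I_m]) \bigcap_(j in [set: 'I_n])
  ((fun A : 'M[R]_(m, n) => A i j) @^-1` [set 0])); last first.
  apply/seteqP; split => [A -> i _ j _ /=|A A0]; first by rewrite mxE.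
  by apply/matrixP => i j; rewrite mxE; exact: A0.
apply: fin_bigcap_measurable => // i _; apply: fin_bigcap_measurable => // j _.
rewrite -[X in measurable X]setTI.
have /measurable_fun_mxP me := @measurable_id _ 'M[R]_(m, n) setT.
exact: (me i j measurableT [set 0]).
Qed.

(** * Null sets of uncontrollable pairs *)

Lemma lebesgue_sym_uncontrollable (R : realType) n (v : 'cV[R]_n) : v != 0 ->
  lebesgue_sym [set X : 'M[R]_n | ~~ controllable X v] = 0%E.
Proof.
move=> v0; have [X XT cX] := exists_sym_controllable v0.
have [t tX] := sym_of_tuple_surj XT.
rewrite /lebesgue_sym /pushforward.
rewrite (_ : _ @^-1` _ =
    [set t | \det (controllability_mx (sym_of_tuple t) v) = 0]).
  apply: (@curve_polynomial_null _ _ _ t).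
  - apply/measurable_det/measurable_controllability_mx => //.
    exact: measurable_sym_of_tuple.
  - exact: curve_polynomial_det_controllability.
  - by rewrite tX -controllableE.
by apply/seteqP; split => u /=; rewrite controllableE negbK => /eqP.
Qed.

(* Unlike [null_set_integral], this does not require [f] to be measurable, which
   spares us the measurability of the spectrum of a matrix. *)
Lemma ge0_null_set_integral d (T : measurableType d) (R : realType)
    (mu : {measure set T -> \bar R}) (N : set T) (f : T -> \bar R) :
  measurable N -> mu N = 0%E -> (forall x, 0 <= f x)%E ->
  (\int[mu]_(x in N) f x = 0)%E.
Proof.
move=> mN N0 f0; apply/eqP; rewrite eq_le integral_ge0 ?andbT//.
rewrite ge0_integralE//; apply: ge_ereal_sup => _ [h /= hf <-].
rewrite sintegralET fsbig1// => r _.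
(* A nonnegative simple [h] below [f] restricted to [N] vanishes off [N], so its level sets at
   nonzero [r] lie in [N] and are null. *)
have [->|r0] := eqVneq r 0; first by rewrite mul0e.
rewrite (subset_measure0 _ mN _ N0) ?mule0// => x /= hx.
apply: contrapT => Nx; have := hf x.
rewrite patchE memNset// hx lee_fin => rle0.
by move: r0; rewrite -hx eq_le {1}hx rle0 fun_ge0.
Qed.

Lemma ensemble_uncontrollable d (T : measurableType d) (R : realType)
    (P : probability T R) n (M : {RV P >-> 'M[R]_n}) (v : 'cV[R]_n) :
  orthogonally_invariant_ensemble M -> v != 0 ->
  distribution P M [set X | ~~ controllable X v] = 0%E.
Proof.
move=> [_ [Q [_ _ ME]]] v0.
have mN : measurable [set X : 'M[R]_n | ~~ controllable X v].
  rewrite (_ : mkset _ =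
      (fun X => \det (controllability_mx X v)) @^-1` [set 0]).
    rewrite -[X in measurable X]setTI.
    by apply: measurable_det => //; exact: measurable_controllability_mx.
  by apply/seteqP; split => u /=; rewrite controllableE negbK => /eqP.
rewrite ME// ge0_null_set_integral ?mule0//.
exact: lebesgue_sym_uncontrollable.
Qed.

(** By independence the law of [(Y, X)] agrees with the product of the laws on rectangles, hence
    everywhere, and the product measure of [N] is the integral of the measures of its sections. *)
Lemma independent_RV_null d d1 d2 (T : measurableType d)
    (T1 : measurableType d1) (T2 : measurableType d2) (R : realType)
    (P : probability T R) (X : {RV P >-> T1}) (Y : {RV P >-> T2})
    (N : set (T2 * T1)) : independent_RV X Y -> measurable N ->
  (forall y, distribution P X (xsection N y) = 0)%E ->
  P [set w | N (Y w, X w)] = 0%E.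
Proof.
move=> XY mN N0.
have mYX : measurable_fun setT (fun w => (Y w, X w)).
  by apply/measurable_fun_pair.
pose joint := measure_function_pushforward__canonical__measure_function_Measure
  P mYX.
rewrite -[LHS]/(joint N).
rewrite -(@product_measure_unique _ _ _ _ _ (distribution P Y)
  (distribution P X) joint)//; last first.
  move=> A B mA mB; rewrite muleC -[RHS]XY// setIC.
  by rewrite /joint /= /pushforward; congr (P _).
by rewrite /product_measure1; under eq_integral do rewrite /= N0;
  rewrite integral0.
Qed.

Theorem corollary3 (R : realType) (d : measure_display) (T : measurableType d)
    (P : probability T R) (n : nat)
    (M : {RV P >-> 'M[R]_n}) (b : {RV P >-> 'cV[R]_n}) :
  (0 < n)%N ->
  orthogonally_invariant_ensemble M ->
  independent_RV M b ->
  P [set w | controllable (M w) (b w)] = (1 - P [set w | b w = 0%R :> 'cV[R]_n])%E.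
Proof.
move=> n0 ensM indMb.
(* Excluding the zero vector makes every section of [N] null: the section over 0 is empty. *)
pose N := [set vX : 'cV[R]_n * 'M[R]_n | vX.1 != 0 /\ ~~ controllable vX.2 vX.1].
have mN : measurable N.
  rewrite (_ : N = (fst @^-1` (~` [set 0])) `&`
      (fun vX => \det (controllability_mx vX.2 vX.1)) @^-1` [set 0]).
    apply: measurableI.
      rewrite -[X in measurable X]setTI; apply: measurable_fst => //.
      by apply: measurableC; exact: (@measurable_mx_set0 R n 1).
    rewrite -[X in measurable X]setTI.
    by apply/measurable_det => //; exact: measurable_controllability_mx.
  apply/seteqP; split => -[v X]; rewrite /N /= controllableE negbK.
    by move=> [/eqP ? /eqP].
  by move=> [/eqP ? ->].
have mN' : measurable [set w | N (b w, M w)].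
  have mbM : measurable_fun setT (fun w => (b w, M w)).
    exact/measurable_fun_pair.
  by rewrite -[X in measurable X]setTI; exact: (mbM measurableT N mN).
have mb0 : measurable [set w | b w = 0].
  rewrite -[X in measurable X]setTI.
  exact: (@measurable_funPT _ _ _ _ b _ _ (@measurable_mx_set0 R n 1)).
have PN : P [set w | N (b w, M w)] = 0%E.
  apply: independent_RV_null indMb mN _ => v.
  have [->|v0] := eqVneq v 0.
    by rewrite (_ : xsection _ _ = set0) ?measure0//; apply/seteqP;
      split => X //; rewrite /xsection /= inE => -[]; rewrite eqxx.
  rewrite (_ : xsection _ _ = [set X | ~~ controllable X v]).
    exact: ensemble_uncontrollable.
  by apply/seteqP; split => X; rewrite /xsection /= inE => // -[].
(* Up to the null event [N], controllability fails exactly when [b = 0]. Here [0 < n] matters: in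
   dimension 0 the zero vector is controllable. *)
have ctrlE : [set w | controllable (M w) (b w)] =
    ~` ([set w | b w = 0] `|` [set w | N (b w, M w)]).
  apply/seteqP; split => w /=.
    move=> cw [b0|[_]]; last by rewrite cw.
    by move: cw; rewrite b0; apply/negP/not_controllable0.
  move=> /not_orP[/eqP b0 /not_andP[//|/negP]].
  by rewrite negbK.
rewrite ctrlE probability_setC ?measureU0//.
exact: measurableU.
Qed.
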